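(* Let $D\subset\mathbb{C}^n$ be a strongly pseudoconvex bounded domain. Let $\Gamma=\{z_j\}\subset D$ be a sequence that is uniformly discrete with respect to the Kobayashi distance of $D$, with $d(z_j,\partial D)<1$ for all $j$. Then $$\sum_{z_j\in\Gamma} d(z_j,\partial D)^{n}\, h\left(-\frac{1}{\log d(z_j,\partial D)}\right)<+\infty$$ for all increasing functions $h\colon\mathbb{R}^+\to\mathbb{R}^+$ such that $$\sum_{m=1}^{+\infty}h\left(\frac{1}{m}\right)<+\infty.$$
   Context: A strongly pseudoconvex bounded domain $D\subset\mathbb{C}^n$ is a bounded connected open set with smooth ($C^\infty$), strongly pseudoconvex boundary. $d(\cdot,\partial D)$ is the Euclidean distance from the boundary of $D$, and $\mathbb{R}^+=[0,+\infty)$. Kobayashi distance: let $k_\Delta(\zeta,\eta)=\tanh^{-1}\left|\frac{\zeta-\eta}{1-\overline{\eta}\zeta}\right|$ be the Poincaré distance of the unit disk $\Delta\subset\mathbb{C}$. The Lempert function of $D$ is $\delta_D(z,w)=\inf\{k_\Delta(\zeta,\eta)\mid \exists\,\phi\colon\Delta\to D \text{ holomorphic}, \phi(\zeta)=z, \phi(\eta)=w\}$, and the Kobayashi distance $k_D$ is the largest pseudodistance on $D$ bounded above by $\delta_D$ (a true distance since $D$ is bounded). A sequence $\{x_j\}$ in a metric space $(X,d)$ is uniformly discrete if there is $\delta>0$ such that $d(x_j,x_k)\ge\delta$ for all $j\ne k$. *)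

(* Defs.v *)
From HB Require Import structures.
From mathcomp Require Import all_boot all_order all_algebra.
From mathcomp Require Import complex.
From mathcomp Require Import all_classical all_reals all_analysis.

Set Implicit Arguments.
Unset Strict Implicit.
Unset Printing Implicit Defensive.

Import Order.TTheory GRing.Theory Num.Theory.
Import ComplexField numFieldNormedType.Exports.

Local Open Scope classical_set_scope.
Local Open Scope ring_scope.

(* The norm topology on R[i], transported from the regular module R[i]^o, so  *)
(* that 'rV[R[i]]_n is a normed module over R[i]. Its library norm is the sup *)
(* norm; it is used only for the topology and for boundedness.                *)
HB.instance Definition _ (R : realType) := GRing.ComAlgebra.copy R[i] R[i]^o.
HB.instance Definition _ (R : realType) := Vector.copy R[i] R[i]^o.
HB.instance Definition _ (R : realType) := NormedModule.copy R[i] R[i]^o.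

Section EuclideanDistance.
Context {R : realType} {n : nat}.
Implicit Types (z w : 'rV[R[i]]_n) (D : set 'rV[R[i]]_n).

Definition euclidean_norm z : R := Num.sqrt (\sum_j Normc.normc (z 0 j) ^+ 2).

Definition boundary D : set 'rV[R[i]]_n := closure D `\` interior D.

Definition dist_boundary D z : R :=
  inf [set euclidean_norm (z - w) | w in boundary D].

End EuclideanDistance.

Section StrongPseudoconvexity.
Context {R : realType} {n : nat}.
Implicit Types (z p v : 'rV[R[i]]_n) (D U : set 'rV[R[i]]_n).
Implicit Types (r : 'rV[R[i]]_n -> R) (j k : 'I_n) (b : bool).

(* The real coordinates of C^n are x_j (b = false) and y_j (b = true), with   *)
(* z_j = x_j + i y_j.                                                         *)
Definition coord_line r j b z (t : R) : R :=
  r (z + (t%:C * (if b then 'i else 1))%C *: delta_mx 0 j).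

Definition partial j b r z : R := derive1 (coord_line r j b z) 0.

Fixpoint of_class_C (m : nat) U r : Prop :=
  (forall z, U z -> {for z, continuous r}) /\
  match m with
  | 0 => True
  | m'.+1 => forall j b,
      (forall z, U z -> derivable (coord_line r j b z) 0 1) /\
      of_class_C m' U (partial j b r)
  end.

Definition smooth_on U r : Prop := forall m, of_class_C m U r.

Local Notation "'\dx_' j" := (partial j false) (at level 0, j at level 2).
Local Notation "'\dy_' j" := (partial j true) (at level 0, j at level 2).

(* d/dz_j = (d/dx_j - i d/dy_j) / 2 *)
Definition wirtinger j r z : R[i] := ((\dx_j r z -i* \dy_j r z) / 2)%C.

(* d^2/(dz_j dzbar_k) = (d/dx_j - i d/dy_j) (d/dx_k + i d/dy_k) / 4 *)
Definition levi_coef j k r z : R[i] :=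
  (((\dx_j (\dx_k r) z + \dy_j (\dy_k r) z) +i*
    (\dx_j (\dy_k r) z - \dy_j (\dx_k r) z)) / 4)%C.

Definition levi_form r p v : R[i] :=
  \sum_j \sum_k levi_coef j k r p * v 0 j * (v 0 k)^*%C.

Definition complex_tangent r p v : Prop := \sum_j wirtinger j r p * v 0 j = 0.

Definition local_defining_function D p U r : Prop :=
  [/\ open U /\ U p,
      smooth_on U r,
      D `&` U = [set z | r z < 0] `&` U &
      forall q, boundary D q -> U q -> exists j b, partial j b r q != 0].

(* In the order of R[i], 0 < c means that c is real and positive. Positivity  *)
(* of the Levi form on the complex tangent space does not depend on the local *)
(* defining function.                                                         *)
Definition smooth_strongly_pseudoconvex_boundary D : Prop :=
  forall p, boundary D p -> exists U r,
    local_defining_function D p U r /\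
    forall v, v != 0 -> complex_tangent r p v -> 0 < levi_form r p v.

Definition strongly_pseudoconvex_bounded_domain D : Prop :=
  [/\ open D, connected D, bounded_set D &
      smooth_strongly_pseudoconvex_boundary D].

End StrongPseudoconvexity.

Definition pseudodistance_on (R : realType) (X : Type) (A : set X) (d : X -> X -> R) : Prop :=
  [/\ forall x y, A x -> A y -> 0 <= d x y,
      forall x, A x -> d x x = 0,
      forall x y, A x -> A y -> d x y = d y x &
      forall x y z, A x -> A y -> A z -> d x z <= d x y + d y z].

Section KobayashiDistance.
Context {R : realType} {n : nat}.
Implicit Types (z w : 'rV[R[i]]_n) (D : set 'rV[R[i]]_n).

Definition artanh (x : R) : R := ln ((1 + x) / (1 - x)) / 2.

Definition unit_disk : set R[i] := [set zeta | `|zeta| < 1].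

Definition poincare (zeta eta : R[i]) : R :=
  artanh (Normc.normc ((zeta - eta) / (1 - eta^*%C * zeta))).

(* phi is a total function of which only the restriction to the unit disk     *)
(* matters; derivable is taken over the field R[i].                           *)
Definition holomorphic_disk D (phi : R[i] -> 'rV[R[i]]_n) : Prop :=
  forall zeta, unit_disk zeta -> D (phi zeta) /\ derivable phi zeta 1.

(* Extended real, +oo when no holomorphic disk in D joins z and w *)
Definition lempert D z w : \bar R :=
  ereal_inf [set x | exists phi zeta eta,
    [/\ holomorphic_disk D phi, unit_disk zeta /\ unit_disk eta,
        phi zeta = z, phi eta = w & x = (poincare zeta eta)%:E]].

(* The largest pseudodistance below the Lempert function, as the pointwise    *)
(* supremum of all of them                                                    *)
Definition kobayashi D z w : \bar R :=
  ereal_sup [set (d z w)%:E | d in [set d | pseudodistance_on D d /\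
    forall x y, D x -> D y -> ((d x y)%:E <= lempert D x y)%E]].

End KobayashiDistance.

Definition uniformly_discrete (R : realType) (X : Type) (d : X -> X -> \bar R)
    (x : nat -> X) : Prop :=
  exists2 delta : R, 0 < delta &
    forall j k, j <> k -> (delta%:E <= d (x j) (x k))%E.

(* Main.v *)
Require Import Defs.
From mathcomp Require Import all_boot all_order all_algebra.
From mathcomp Require Import complex.
From mathcomp Require Import all_classical all_reals all_analysis.
From mathcomp Require Import ring lra.

Set Implicit Arguments.
Unset Strict Implicit.
Unset Printing Implicit Defensive.

Import Order.TTheory GRing.Theory Num.Theory.
Import numFieldNormedType.Exports.

Local Open Scope classical_set_scope.
Local Open Scope ring_scope.

(** Group the points of the sequence by the shells
    exp (- (m + 1)) < d <= exp (- m), where d is the distance to the boundary.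
    On the shell of index m >= 1 the summand is at most
    exp (- n m) h (1 / m), because - 1 / log d <= 1 / m and h is increasing.
    So it suffices that, for large m, this shell contains at most C exp (n m)
    points with C independent of m, and that the other shells together contain
    finitely many points: the tail of the sum is then bounded by C times the sum
    of h (1 / m).

    The count comes from the shape of Kobayashi balls.  If the flat disk
    a |-> z + a (w - z) maps the disk of radius 1 / eps into D, then z and w
    are at Kobayashi distance at most artanh eps
    ([lempert_le_linear_disk]); hence distinct points of a uniformly discrete
    sequence never span such a disk
    ([uniformly_discrete_disk_separated]).  Near a boundary point with defining
    function r, the second-order Taylor estimate
      r (z + v) <= r z + 2 Re (dr(z) v) + L |v|^2,
    where dr(z) is the complex linear part of the differential, and the fact
    that - r z is comparable to d show that the disk through z and z + v stays
    in D as soon as |dr(z) v| is small compared with d and |v| is small compared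
    with sqrt d ([linear_disk_in_domain]).  Such v fill a polydisk of size d in
    the complex normal direction and sqrt d in the n - 1 complex tangential
    ones.

    It remains to cut the shell d <= s^2 into cells in which any two points are
    related in this way, and to count the cells ([shell_count]).  All real
    coordinates but one, transversal to the boundary, are known up to eta s, and
    r is known up to eta s^2; this determines the last coordinate up to O(eta s)
    and, by Taylor, Re (dr(z) v) up to O(eta s^2).  The imaginary part of the
    same form is not the differential of a function, but within one cell its
    coefficients vary by O(s) only, so it can be measured from a base point
    chosen in the cell, where it takes values of size O(s) and is again cut into
    pieces of size eta s^2.  That gives 2n - 1 coordinates and one imaginary
    part, each with O(1 / s) values, and boundedly many values of r: in total
    O(s^(- 2n)) = O(d^(- n)) cells.  Two sequence points in the same cell would
    span a forbidden disk, so this bounds the number of points.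

    Compactness of the boundary ([few_in_all_shells]) makes the constants
    uniform, and away from the boundary a grid of equal cubes shows that only
    finitely many points are involved
    ([finitely_many_away_from_boundary]). *)

(** * Real coordinates, norms and boxes in complex affine space *)

Section RealCoordinates.
Context {R : realType} {n : nat}.
Implicit Types (z w p v : 'rV[R[i]]_n) (k l : 'I_n * bool) (t rho : R).

Definition crd k z : R :=
  if k.2 then complex.Im (z 0 k.1) else complex.Re (z 0 k.1).

Definition move k t z : 'rV[R[i]]_n :=
  z + (t%:C * (if k.2 then 'i else 1))%C *: delta_mx 0 k.1.

(** The l1 norm of the 2n real coordinates: it is additive along paths that
    change one coordinate at a time. *)
Definition onorm v : R := \sum_k `|crd k v|.

Definition box p rho : set 'rV[R[i]]_n :=
  [set z | forall k, `|crd k (z - p)| < rho].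

Lemma crdB k z w : crd k (z - w) = crd k z - crd k w.
Proof.
by rewrite /crd !mxE; case: (z 0 _) (w 0 _) => [a b] [c d]; case: k.2.
Qed.

Lemma crd_distC k z w : `|crd k (z - w)| = `|crd k (w - z)|.
Proof. by rewrite !crdB distrC. Qed.

Lemma crd_inj z w : (forall k, crd k z = crd k w) -> z = w.
Proof.
move=> E; apply/rowP => j; have := E (j, false); have := E (j, true).
by rewrite /crd /=; case: (z 0 j) (w 0 j) => [a b] [c d] /= -> ->.
Qed.

Lemma crd_move k l t z : crd k (move l t z) = crd k z + (if k == l then t else 0).
Proof.
rewrite /crd /move !mxE; case: k l => j b [j' b'] /=; rewrite xpair_eqE.
case: (z 0 j) => x y; case: (j == j') => /=; case: b; case: b' => /=; ring.
Qed.

Lemma move_move k s t z : move k s (move k t z) = move k (t + s) z.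
Proof. by apply: crd_inj => l; rewrite !crd_move; case: eqP => _; ring. Qed.

Lemma move0 k z : move k 0 z = z.
Proof. by apply: crd_inj => l; rewrite !crd_move; case: eqP => _; ring. Qed.

Lemma onorm_ge0 v : 0 <= onorm v.
Proof. exact: sumr_ge0. Qed.

Lemma crd_le_onorm k v : `|crd k v| <= onorm v.
Proof. by rewrite /onorm (bigD1 k) //= lerDl sumr_ge0. Qed.

Lemma onormB z w : onorm (z - w) = onorm (w - z).
Proof. by apply: eq_bigr => k _; rewrite crd_distC. Qed.

Lemma onorm_le_const v t : (forall k, `|crd k v| <= t) -> onorm v <= n.*2%:R * t.
Proof.
move=> vt; apply: (@le_trans _ _ (\sum_(k : 'I_n * bool) t)).
  exact: ler_sum.
by rewrite sumr_const card_prod card_ord card_bool mulr_natl muln2.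
Qed.

Lemma normcE_sqrt (c : R[i]) :
  Normc.normc c = Num.sqrt (complex.Re c ^+ 2 + complex.Im c ^+ 2).
Proof. by case: c. Qed.

Lemma normC_normc (c : R[i]) : `|c| = (Normc.normc c)%:C%C.
Proof. by rewrite normc_def normcE_sqrt. Qed.

Lemma Re_le_normc (c : R[i]) : `|complex.Re c| <= Normc.normc c.
Proof. by rewrite normcE_sqrt -sqrtr_sqr ler_wsqrtr // lerDl sqr_ge0. Qed.

Lemma Im_le_normc (c : R[i]) : `|complex.Im c| <= Normc.normc c.
Proof. by rewrite normcE_sqrt -sqrtr_sqr ler_wsqrtr // lerDr sqr_ge0. Qed.

Lemma normc_ge0 (c : R[i]) : 0 <= Normc.normc c.
Proof. by rewrite normcE_sqrt sqrtr_ge0. Qed.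

Lemma normc_le_ReIm (c : R[i]) :
  Normc.normc c <= `|complex.Re c| + `|complex.Im c|.
Proof.
rewrite normcE_sqrt -[leRHS]ger0_norm ?addr_ge0 // -sqrtr_sqr ler_wsqrtr //.
rewrite sqrrD !real_normK ?num_real // -addrA [_ *+ 2 + _]addrC addrA lerDl.
by rewrite mulrn_wge0 // mulr_ge0.
Qed.

Lemma crd_le_normc k z : `|crd k z| <= Normc.normc (z 0 k.1).
Proof. by rewrite /crd; case: k.2; rewrite ?Re_le_normc ?Im_le_normc. Qed.

Lemma normc_le_crd (j : 'I_n) z :
  Normc.normc (z 0 j) <= `|crd (j, false) z| + `|crd (j, true) z|.
Proof. exact: normc_le_ReIm. Qed.

Lemma onormE v : onorm v = \sum_j (`|crd (j, false) v| + `|crd (j, true) v|).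
Proof.
rewrite /onorm -(pair_bigA _ (fun j b => `|crd (j, b) v|)) /=.
by apply: eq_bigr => j _; rewrite big_bool addrC.
Qed.

Lemma crd_le_euclidean k z : `|crd k z| <= euclidean_norm z.
Proof.
apply: (le_trans (crd_le_normc k z)); rewrite /euclidean_norm.
rewrite -[leLHS]ger0_norm ?normc_ge0 // -sqrtr_sqr ler_wsqrtr //.
by rewrite (bigD1 k.1) //= lerDl sumr_ge0 // => j _; rewrite sqr_ge0.
Qed.

(** The square of a sum of nonnegative numbers dominates the sum of squares. *)
Lemma euclidean_le_onorm z : euclidean_norm z <= onorm z.
Proof.
have Sge0 (s : seq 'I_n) : 0 <= \sum_(j <- s) Normc.normc (z 0 j).
  by rewrite sumr_ge0 // => j _; rewrite normc_ge0.
apply: (@le_trans _ _ (\sum_j Normc.normc (z 0 j))).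
  rewrite /euclidean_norm -[leRHS]ger0_norm ?Sge0 // -sqrtr_sqr ler_wsqrtr //.
  elim: (index_enum _) => [|j s IH]; first by rewrite !big_nil sqr_ge0.
  rewrite !big_cons sqrrD -addrA lerD2l (le_trans IH) // lerDr.
  by rewrite mulrn_wge0 // mulr_ge0 // normc_ge0.
by rewrite onormE; apply: ler_sum => j _; exact: normc_le_crd.
Qed.

Lemma box_trans p rho sigma z w :
  box p rho z -> box z sigma w -> box p (rho + sigma) w.
Proof.
move=> pz zw k; have := pz k; have := zw k; rewrite !crdB => h1 h2.
rewrite (_ : crd k w - _ = (crd k z - crd k p) + (crd k w - crd k z)); last ring.
by rewrite (le_lt_trans (ler_normD _ _)) // ltrD.
Qed.

Lemma box_sub p rho sigma : rho <= sigma -> box p rho `<=` box p sigma.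
Proof. by move=> rs z zp k; rewrite (lt_le_trans (zp k)). Qed.

Lemma onorm_box p rho z : onorm (z - p) < rho -> box p rho z.
Proof. by move=> h k; rewrite (le_lt_trans (crd_le_onorm k _)). Qed.

Lemma nbhs_box p (A : set 'rV[R[i]]_n) :
  nbhs p A -> exists2 rho, 0 < rho & box p rho `<=` A.
Proof.
move=> /nbhs_ballP[e /= e0 eA]; exists (complex.Re e / 2).
  by move: e0; rewrite ltcE /= => /andP[_ e0]; rewrite divr_gt0.
have eE : e = (complex.Re e)%:C%C by rewrite RRe_real // gtr0_real.
move=> z zp; apply: eA; split=> // i j; rewrite ord1 eE -ball_normE /=.
rewrite normC_normc ltcR.
have := normc_le_crd j (p - z); rewrite !mxE => /le_lt_trans; apply.
by rewrite [ltRHS]splitr ltrD // crd_distC; exact: zp.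
Qed.

Lemma box_nbhs p rho : 0 < rho -> nbhs p (box p rho).
Proof.
move=> r0; apply/nbhs_ballP; exists (rho%:C)%C; first by rewrite /= ltcR.
move=> z [_ pz] k; have := pz 0 k.1.
rewrite -ball_normE /= normC_normc ltcR => h.
rewrite crd_distC; apply: le_lt_trans (crd_le_normc k _) _.
by rewrite !mxE.
Qed.

End RealCoordinates.

(** * Mean value and Taylor estimates in a box *)
Section MeanValue.
Context {R : realType} {n : nat}.
Implicit Types (z w p v : 'rV[R[i]]_n) (k l : 'I_n * bool) (t rho : R).
Implicit Types (f : 'rV[R[i]]_n -> R).

Definition has_partials f (A : set 'rV[R[i]]_n) :=
  forall z, A z -> forall k, derivable (coord_line f k.1 k.2 z) 0 1.

Lemma box_convex p rho k t theta z : box p rho z -> box p rho (move k t z) ->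
  0 <= theta <= 1 -> box p rho (move k (theta * t) z).
Proof.
move=> zp wp /andP[t0 t1] l; have := zp l; have := wp l.
rewrite !crdB !crd_move; case: (l == k); last by rewrite !addr0.
(* The moved coordinate lies between its two end values. *)
rewrite !ltr_norml => /andP[a1 a2] /andP[b1 b2].
by have [t0'|/ltW t0'] := lerP 0 t; apply/andP; split; nra.
Qed.

Lemma mean_value_move f p rho k t z : has_partials f (box p rho) ->
  box p rho z -> box p rho (move k t z) ->
  exists2 theta, 0 <= theta <= 1 &
    f (move k t z) - f z = partial k.1 k.2 f (move k (theta * t) z) * t.
Proof.
move=> df zp wp.
pose g (u : R) := f (move k (u * t) z).
have dg (u : R) : u \in `[0, 1] ->
    is_derive u 1 g (partial k.1 k.2 f (move k (u * t) z) * t).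
  rewrite in_itv /= => u01; set y := move k (u * t) z.
  have dy := df _ (box_convex zp wp u01) k.
  have -> : g = coord_line f k.1 k.2 y \o (fun x => (x - u) * t).
    apply/funext => x; rewrite /g /= /coord_line -/(move k ((x - u) * t) y).
    by rewrite /y move_move; congr (f (move _ _ _)); ring.
  apply: is_derive1_comp; last first.
    have du := is_deriveZ t (is_deriveB (is_derive_id u (1 : R))
                                        (is_derive_cst u u (1 : R))).
    have -> : (fun x : R => (x - u) * t) = t \*: (id - cst u).
      by apply/funext => x; rewrite /= mulrC.
    by apply: is_derive_eq; rewrite subr0 [t *: 1]mulr1.
  by rewrite subrr mul0r /partial derive1E; apply: derivableP.
have cg : {within `[0, 1], continuous g}.
  by apply: derivable_within_continuous => u /dg[].
have dgo (u : R) : u \in `]0, 1[ ->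
    is_derive u 1 g (partial k.1 k.2 f (move k (u * t) z) * t).
  by move=> u01; apply: dg; apply: subset_itv_oo_cc.
have [theta th01 E] := MVT_segment ler01 dgo cg.
by exists theta => //; move: E; rewrite /g mul1r mul0r move0 subr0 mulr1.
Qed.

(** Go from z to w by changing one coordinate at a time, applying the
    one-variable mean value theorem on each step; boxes are products of
    intervals, so the path stays inside. *)
Lemma mean_value_box f p rho z w : has_partials f (box p rho) ->
  box p rho z -> box p rho w ->
  exists2 xi : 'I_n * bool -> 'rV[R[i]]_n,
    forall k, box p rho (xi k) /\ onorm (xi k - z) <= onorm (w - z) &
    f w - f z = \sum_k partial k.1 k.2 f (xi k) * crd k (w - z).
Proof.
move=> df.
(* Induction on the list s of coordinates in which z and w may still differ. *)
suff H (s : seq ('I_n * bool)) : uniq s -> forall z, box p rho z -> box p rho w ->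
    (forall k, k \notin s -> crd k (w - z) = 0) ->
    exists2 xi : 'I_n * bool -> 'rV[R[i]]_n,
      forall k, box p rho (xi k) /\
                (forall l, `|crd l (xi k - z)| <= `|crd l (w - z)|) &
      f w - f z = \sum_(k <- s) partial k.1 k.2 f (xi k) * crd k (w - z).
  move=> zp wp; have [|xi xiP E] := H _ (index_enum_uniq _) z zp wp.
    by move=> k; rewrite mem_index_enum.
  exists xi => // k; have [xip xiz] := xiP k.
  by split=> //; apply: ler_sum.
elim: s => [_ {z} z zp wp zw|k s IH /= /andP[ks us] {z} z zp wp zw].
  exists (fun=> z) => [k|]; first by split=> // l; rewrite crdB subrr normr0.
  rewrite big_nil (_ : w = z) ?subrr //; apply: crd_inj => l.
  by apply/eqP; rewrite -subr_eq0 -crdB zw.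
set t := crd k (w - z); set y := move k t z.
have yE l : crd l y = if l == k then crd l w else crd l z.
  rewrite /y crd_move /t; case: eqP => [->|_]; last exact: addr0.
  by rewrite crdB addrC subrK.
have yp : box p rho y.
  by move=> l; rewrite crdB yE; case: eqP => _; rewrite -crdB.
have [|xi xiP E] := IH us y yp wp.
  move=> l ls; rewrite crdB yE; case: eqP => [|/eqP lk]; first by rewrite subrr.
  by rewrite -crdB zw // inE negb_or lk.
have [theta th01 E1] := mean_value_move df zp yp.
exists (fun l => if l == k then move k (theta * t) z else xi l).
  move=> l; case: eqP => _.
    split; first exact: box_convex.
    move=> m; rewrite !crdB crd_move; case: eqP => [->|_]; last first.
      by rewrite addr0 subrr normr0.
    rewrite addrC addKr -crdB -/t normrM ler_piMl //.
    by rewrite ger0_norm; case/andP: th01.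
  have [xip xiy] := xiP l; split=> // m; have := xiy m.
  rewrite !crdB yE; case: eqP => [->|//]; rewrite subrr normr0 => h.
  suff -> : crd k (xi l) = crd k w by [].
  by apply/eqP; rewrite -subr_eq0 -normr_le0.
have -> : f w - f z = (f y - f z) + (f w - f y) by ring.
rewrite big_cons eqxx E E1; congr (_ + _); apply: eq_big_seq => l ls.
have lk : l != k by apply: contraNneq ks => <-.
by rewrite (negPf lk) !crdB yE (negPf lk).
Qed.

Lemma lipschitz_box f p rho (L : R) z w : has_partials f (box p rho) ->
  (forall y k, box p rho y -> `|partial k.1 k.2 f y| <= L) ->
  box p rho z -> box p rho w -> `|f w - f z| <= L * onorm (w - z).
Proof.
move=> df fL zp wp; have [xi xiP ->] := mean_value_box df zp wp.
rewrite (le_trans (ler_norm_sum _ _ _)) // /onorm mulr_sumr ler_sum // => k _.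
by rewrite normrM ler_wpM2r // fL //; case: (xiP k).
Qed.

(** Lipschitz partial derivatives suffice for a quadratic remainder: replace the
    derivatives at the intermediate points of the mean value formula by those
    at z. *)
Lemma taylor_box f p rho (L : R) z w : has_partials f (box p rho) ->
  (forall y y' k, box p rho y -> box p rho y' ->
     `|partial k.1 k.2 f y - partial k.1 k.2 f y'| <= L * onorm (y - y')) ->
  0 <= L ->
  box p rho z -> box p rho w ->
  `|f w - f z - \sum_k partial k.1 k.2 f z * crd k (w - z)|
    <= L * onorm (w - z) ^+ 2.
Proof.
move=> df fL L0 zp wp; have [xi xiP ->] := mean_value_box df zp wp.
rewrite -sumrB (le_trans (ler_norm_sum _ _ _)) // expr2 mulrA /onorm mulr_sumr.
apply: ler_sum => k _; rewrite -mulrBl normrM ler_wpM2r //.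
have [xip xiz] := xiP k.
by rewrite (le_trans (fL _ _ _ xip zp)) // ler_wpM2l.
Qed.

End MeanValue.

(** * Boundary charts *)
Section BoundaryChart.
Context {R : realType} {n : nat}.
Implicit Types (z w p v : 'rV[R[i]]_n) (k l e : 'I_n * bool) (t rho L c sigma : R).
Implicit Types (f r : 'rV[R[i]]_n -> R) (D U : set 'rV[R[i]]_n).

(** A box around p where D is the sublevel set r < 0, with uniform bounds on r
    and its first derivatives, and a real coordinate direction e along which
    sigma r increases at rate at least c: moving by t in that direction, with
    the sign given by sigma, raises r by at least c t. *)
Record boundary_chart D p rho r L c sigma e : Prop := BoundaryChart {
  chart_rho : 0 < rho;
  chart_L : 1 <= L;
  chart_c : 0 < c;
  chart_sigma : `|sigma| = 1;
  chart_domain : forall z, box p rho z -> (D z <-> r z < 0);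
  chart_grad_le : forall z k, box p rho z -> `|partial k.1 k.2 r z| <= L;
  chart_grad_lip : forall z w k, box p rho z -> box p rho w ->
    `|partial k.1 k.2 r z - partial k.1 k.2 r w| <= L * onorm (z - w);
  chart_lip : forall z w, box p rho z -> box p rho w ->
    `|r w - r z| <= L * onorm (w - z);
  chart_taylor : forall z w, box p rho z -> box p rho w ->
    `|r w - r z - \sum_k partial k.1 k.2 r z * crd k (w - z)|
      <= L * onorm (w - z) ^+ 2;
  chart_transversal : forall z t, 0 <= t -> box p rho z ->
    box p rho (move e (sigma * t) z) ->
    c * t <= r (move e (sigma * t) z) - r z }.

Lemma locally_bounded_at f p : {for p, continuous f} ->
  \forall z \near p, `|f z| <= `|f p| + 1.
Proof.
move=> /cvgr_dist_lt /(_ _ ltr01); apply: filterS => z.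
by rewrite distrC => /ltW h; rewrite -lerBlDl (le_trans (lerB_dist _ _)).
Qed.

(** Continuity of the derivatives of order at most two at p bounds them in a
    neighbourhood of p by their values at p plus one; the direction e is one in
    which the derivative of r does not vanish at p. *)
Lemma boundary_chart_exists D p U r : local_defining_function D p U r ->
  boundary D p -> exists rho L c sigma e, boundary_chart D p rho r L c sigma e.
Proof.
move=> [[oU Up] smooth DU nondeg] bp.
have [j [b gp]] := nondeg p bp Up; pose e := (j, b).
pose g k := partial k.1 k.2 r.
have [_ C2] := smooth 2%N.
have dr z k : U z -> derivable (coord_line r k.1 k.2 z) 0 1.
  by move=> Uz; have [+ _] := C2 k.1 k.2; apply.
have cg z k : U z -> {for z, continuous (g k)}.
  by move=> Uz; have [_ [+ _]] := C2 k.1 k.2; apply.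
have dg z k l : U z -> derivable (coord_line (g k) l.1 l.2 z) 0 1.
  by move=> Uz; have [_ [_ /(_ l.1 l.2)[+ _]]] := C2 k.1 k.2; apply.
have cgg z k l : U z -> {for z, continuous (partial l.1 l.2 (g k))}.
  by move=> Uz; have [_ [_ /(_ l.1 l.2)[_ [+ _]]]] := C2 k.1 k.2; apply.
pose sigma := Num.sg (g e p); pose c := `|g e p| / 2.
have c0 : 0 < c by rewrite divr_gt0 // normr_gt0.
have sig1 : `|sigma| = 1 by rewrite normr_sg gp.
(* L bounds all first and second derivatives near p at once. *)
pose A := \sum_k (`|g k p| + 1).
pose B := \sum_(kl : ('I_n * bool) * ('I_n * bool))
            (`|partial kl.2.1 kl.2.2 (g kl.1) p| + 1).
pose L := 1 + A + B.
have A0 : 0 <= A by rewrite sumr_ge0 // => i _; rewrite addr_ge0.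
have B0 : 0 <= B by rewrite sumr_ge0 // => i _; rewrite addr_ge0.
have L1 k : `|g k p| + 1 <= L.
  suff h : `|g k p| + 1 <= A by apply: (le_trans h); rewrite /L; lra.
  by rewrite /A (bigD1 k) //= lerDl sumr_ge0 // => i _; rewrite addr_ge0.
have L2 k l : `|partial l.1 l.2 (g k) p| + 1 <= L.
  suff h : `|partial l.1 l.2 (g k) p| + 1 <= B.
    by apply: (le_trans h); rewrite /L; lra.
  by rewrite /B (bigD1 (k, l)) //= lerDl sumr_ge0 // => i _; rewrite addr_ge0.
have L3 : 1 <= L by rewrite /L; lra.
have nU : \forall z \near p, U z by apply: open_nbhs_nbhs.
have n1 : \forall z \near p, forall k, `|g k z| <= `|g k p| + 1.
  exact: (filter_forall _ (fun k => locally_bounded_at (cg p k Up))).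
have n2 : \forall z \near p, forall kl : ('I_n * bool) * ('I_n * bool),
    `|partial kl.2.1 kl.2.2 (g kl.1) z| <= `|partial kl.2.1 kl.2.2 (g kl.1) p| + 1.
  exact: (filter_forall _ (fun kl => locally_bounded_at (cgg p kl.1 kl.2 Up))).
have n3 : \forall z \near p, c <= sigma * g e z.
  have /cvgr_dist_lt /(_ _ c0) := cg p e Up; apply: filterS => z h.
  have : sigma * g e p - sigma * g e z <= c.
    rewrite -mulrBr (le_trans (ler_norm _)) // normrM sig1 mul1r.
    exact: ltW.
  have : sigma * g e p = `|g e p| by rewrite normrEsg.
  by rewrite /c => ->; lra.
have /nbhs_box[rho rho0 hrho] : \forall z \near p, [/\ U z,
    forall k, `|g k z| <= `|g k p| + 1,
    (forall kl : ('I_n * bool) * ('I_n * bool),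
    `|partial kl.2.1 kl.2.2 (g kl.1) z| <= `|partial kl.2.1 kl.2.2 (g kl.1) p| + 1)
    & c <= sigma * g e z].
  by near=> z; split; near: z.
have Ub z : box p rho z -> U z by case/hrho.
have gL z k : box p rho z -> `|g k z| <= L.
  by move=> /hrho[_ /(_ k) h _ _]; exact: le_trans h (L1 k).
have ggL z k l : box p rho z -> `|partial l.1 l.2 (g k) z| <= L.
  by move=> /hrho[_ _ /(_ (k, l)) h _]; exact: le_trans h (L2 k l).
have glip z w k : box p rho z -> box p rho w -> `|g k z - g k w| <= L * onorm (z - w).
  move=> zp wp; apply: (@lipschitz_box _ _ _ p rho) => //.
    by move=> y /Ub Uy l; apply: dg.
  by move=> y l yp; exact: ggL.
have drb : has_partials r (box p rho) by move=> y /Ub Uy k; exact: dr.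
exists rho, L, c, sigma, e; split=> //.
- move=> z zp; have /predeqP/(_ z)[h1 h2] := DU; split=> [Dz|rz].
    by have [] := h1 (conj Dz (Ub _ zp)).
  by have [] := h2 (conj rz (Ub _ zp)).
- by move=> z w; apply: (lipschitz_box drb) => y k; exact: gL.
- move=> z w zp wp; apply: (taylor_box drb) => //.
  exact: le_trans L3.
- move=> z t t0 zp mp; have [th th01 ->] := mean_value_move drb zp mp.
  have [_ _ _] := hrho _ (box_convex zp mp th01).
  rewrite mulrA [_ * sigma]mulrC => h; exact: ler_wpM2r.
Unshelve. all: by end_near. Qed.

End BoundaryChart.

(** * Kobayashi distance and flat disks *)
Section LinearDisks.
Context {R : realType} {n : nat}.
Implicit Types (z w : 'rV[R[i]]_n) (D : set 'rV[R[i]]_n).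

Lemma kobayashi_le_lempert D z w : D z -> D w ->
  (kobayashi D z w <= lempert D z w)%E.
Proof.
by move=> Dz Dw; apply: ge_ereal_sup => _ [d [_ dl] <-]; exact: dl.
Qed.

Lemma derivable_affine_disk z w (a zeta : R[i]) :
  derivable (fun x : R[i] => z + (x * a) *: w) zeta 1.
Proof.
apply/cvg_ex; exists (a *: w); apply: cvg_near_cst.
near=> h; rewrite /= [h *: 1]mulr1 opprD addrACA subrr add0r -scalerBl.
rewrite -mulrBl addrK scalerA mulrA mulVf ?mul1r //.
by near: h; exact: nbhs_dnbhs_neq.
Unshelve. all: by end_near. Qed.

(** The affine disk x |-> z + (x / eps) (w - z) sends 0 to z and eps to w, and
    the Poincare distance from 0 to eps is artanh eps. *)
Lemma lempert_le_linear_disk D z w (eps : R) : 0 < eps < 1 ->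
  (forall c : R[i], Normc.normc c < eps^-1 -> D (z + c *: (w - z))) ->
  (lempert D z w <= (artanh eps)%:E)%E.
Proof.
move=> /andP[e0 e1] disk; apply: ereal_inf_lbound.
exists (fun x => z + (x * (eps^-1)%:C%C) *: (w - z)), 0, (eps%:C)%C; split.
- move=> x; rewrite /unit_disk /= normC_normc (ltcR _ 1) => x1; split.
    apply: disk; rewrite Normc.normcM /= expr0n addr0 sqrtr_sqr.
    by rewrite gtr0_norm ?invr_gt0 // gtr_pMl // invr_gt0.
  exact: derivable_affine_disk.
- split; first by rewrite /unit_disk /= normr0 ltr01.
  rewrite /unit_disk /= normC_normc (ltcR _ 1) /= expr0n addr0.
  by rewrite sqrtr_sqr gtr0_norm.
- by rewrite mul0r scale0r addr0.
- by rewrite -rmorphM /= mulfV ?gt_eqF // scale1r addrC subrK.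
- congr (_%:E); rewrite /poincare mulr0 subr0 divr1 sub0r; congr artanh.
  by rewrite /= oppr0 expr0n addr0 sqrtr_sqr normrN gtr0_norm.
Qed.

(** Turns discreteness for the Kobayashi distance into a condition on complex
    lines: distinct points of the sequence are not joined by a flat disk in D
    that is lambda times larger than their separation. *)
Lemma uniformly_discrete_disk_separated D (x : nat -> 'rV[R[i]]_n) :
  (forall j, D (x j)) -> uniformly_discrete (kobayashi D) x ->
  exists2 lambda : R, 0 < lambda & forall j k,
    (forall c : R[i], Normc.normc c < lambda -> D (x j + c *: (x k - x j))) ->
    j = k.
Proof.
(* This eps is tanh (delta / 2), so that artanh eps = delta / 2. *)
move=> Dx [delta d0 sep]; pose E := expR delta; pose eps := (E - 1) / (E + 1).
have E1 : 1 < E by rewrite expR_gt1.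
have eps01 : 0 < eps < 1.
  rewrite divr_gt0 ?subr_gt0 ?addr_gt0 ?expR_gt0 //=.
  by rewrite ltr_pdivrMr; lra.
exists eps^-1; first by rewrite invr_gt0; case/andP: eps01.
move=> j k disk; apply/eqP/negPn/negP => /eqP jk.
have := sep j k jk; apply/negP; rewrite -ltNge.
apply: (le_lt_trans (kobayashi_le_lempert (Dx j) (Dx k))).
apply: (le_lt_trans (lempert_le_linear_disk eps01 disk)).
rewrite lte_fin /artanh (_ : (1 + eps) / (1 - eps) = E).
  by rewrite expRK ltr_pdivrMr //; lra.
by rewrite /eps; field; lra.
Qed.

End LinearDisks.

(** * Distance to the boundary and compactness *)
Section BoundaryTopology.
Context {R : realType} {n : nat}.
Implicit Types (z w q v : 'rV[R[i]]_n) (D : set 'rV[R[i]]_n).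

Lemma crd_scale k (t : R) v : crd k (t%:C%C *: v) = t * crd k v.
Proof. by rewrite /crd !mxE; case: (v 0 _) => a b; case: k.2 => /=; ring. Qed.

Lemma onorm_scale (t : R) v : onorm (t%:C%C *: v) = `|t| * onorm v.
Proof.
by rewrite /onorm mulr_sumr; apply: eq_bigr => k _; rewrite crd_scale normrM.
Qed.

Lemma continuous_segment z v : continuous (fun t : R => z + t%:C%C *: v).
Proof.
move=> t A /nbhs_box[rho rho0 rA].
have M0 : 0 < onorm v + 1 by rewrite ltr_wpDl // onorm_ge0.
have /cvgr_dist_lt/(_ (rho / (onorm v + 1))) := @cvg_id _ (nbhs t).
rewrite divr_gt0 // => /(_ isT); apply: filterS => s st.
apply: rA; apply: onorm_box.
rewrite opprD addrACA subrr add0r -scalerBl -rmorphB onorm_scale distrC.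
by move: st; rewrite ltr_pdivlMr //; have := normr_ge0 (t - s); nra.
Qed.

(** Otherwise the parameters whose point is in D form a nonempty open and closed
    proper part of the unit interval. *)
Lemma segment_meets_boundary D z w : open D -> D z -> ~ D w ->
  exists2 q, boundary D q & onorm (z - q) <= onorm (z - w).
Proof.
move=> oD Dz nDw; pose f t := z + t%:C%C *: (w - z).
have cf : continuous f by exact: continuous_segment.
suff [t t01 bt] : exists2 t : R, 0 <= t <= 1 & boundary D (f t).
  exists (f t) => //; rewrite onormB /f addrC addKr onorm_scale onormB.
  by rewrite ler_piMl ?onorm_ge0 // ger0_norm; case/andP: t01.
apply: contrapT => nb.
have inD t : 0 <= t <= 1 -> closure D (f t) -> D (f t).
  move=> t01 ct; apply: contrapT => nD; apply: nb; exists t => //.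
  by split=> // /interior_subset.
have /seteqP[_ h] : `[0, 1]%classic `&` f @^-1` D = `[0, 1]%classic.
  apply: (@segment_connected R 0 1).
  - exists 0; split; first by rewrite /= in_itv /= lexx ler01.
    by rewrite /f /= scale0r addr0.
  - by exists (f @^-1` D) => //; apply: open_comp => // t _; exact: cf.
  - exists (f @^-1` closure D).
      by apply: closed_comp => [t _|]; [exact: cf | exact: closed_closure].
    apply/seteqP; split=> t [t01 Dt]; split=> //; first exact: subset_closure.
    by apply: inD => //; move: t01; rewrite /= in_itv.
have [|_] := h 1; first by rewrite /= in_itv /= lexx ler01.
by rewrite /f /= scale1r addrC subrK.
Qed.

Lemma dist_boundary_le D z q : boundary D q ->
  dist_boundary D z <= euclidean_norm (z - q).
Proof.
move=> bq; apply: ge_inf; last by exists q.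
by exists 0 => _ [w _ <-]; exact: sqrtr_ge0.
Qed.

Lemma dist_boundary_adherent D z (eta : R) : boundary D !=set0 -> 0 < eta ->
  exists2 q, boundary D q & euclidean_norm (z - q) < dist_boundary D z + eta.
Proof.
move=> [q0 bq0] eta0.
have [|_ [q bq <-] h] :=
    @inf_adherent _ [set euclidean_norm (z - w) | w in boundary D] _ eta0.
  split; first by exists (euclidean_norm (z - q0)); exists q0.
  by exists 0 => _ [w _ <-]; exact: sqrtr_ge0.
by exists q.
Qed.

Lemma boundary_not_in D q : open D -> boundary D q -> ~ D q.
Proof. by move=> oD [_ nq] Dq; apply: nq; rewrite (interior_id D).1. Qed.

Lemma dist_boundary_gt0 D z : open D -> boundary D !=set0 -> D z ->
  0 < dist_boundary D z.
Proof.
move=> oD [q0 bq0] Dz.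
have /nbhs_box[rho rho0 rD] : nbhs z D by apply: open_nbhs_nbhs.
apply: (lt_le_trans rho0); apply: lb_le_inf.
  by exists (euclidean_norm (z - q0)); exists q0.
move=> _ [q bq <-]; rewrite leNgt; apply/negP => h.
apply: (boundary_not_in oD bq); apply: rD => k.
by rewrite crd_distC (le_lt_trans (crd_le_euclidean k _)).
Qed.

Lemma dist_boundary_ball D z w : open D -> D z ->
  onorm (z - w) < dist_boundary D z -> D w.
Proof.
move=> oD Dz zw; apply: contrapT => nDw.
have [q bq h] := segment_meets_boundary oD Dz nDw.
have := dist_boundary_le z bq; have := euclidean_le_onorm (z - q).
by move: zw h; lra.
Qed.

Lemma bounded_crd D : bounded_set D ->
  exists2 M : R, 0 < M & forall z k, D z -> `|crd k z| <= M.
Proof.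
move=> [M [rM /(_ (M + 1))]]; rewrite ltrDl ltr01 => /(_ isT) DM.
exists (`|complex.Re M| + 2); first by rewrite ltr_wpDl.
move=> z k /DM /= zM.
have : ball (0 : 'rV[R[i]]_n) (M + 2) z.
  rewrite mx_norm_ball /ball_ /= sub0r normrN (le_lt_trans zM) //.
  by rewrite ltrD2l ltr1n.
move=> [_ zb]; have := zb 0 k.1; rewrite -ball_normE /= mxE sub0r normrN.
have -> : M + 2 = (complex.Re M + 2)%:C%C by rewrite rmorphD /= RRe_real // rmorph_nat.
rewrite normC_normc ltcR => /ltW h.
apply: (le_trans (crd_le_normc k z)); apply: (le_trans h).
by rewrite lerD2r ler_norm.
Qed.

Lemma continuous_complex : continuous (fun x : R * R => (x.1 +i* x.2)%C).
Proof.
move=> x; apply/cvgrPdist_lt => e e0.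
have eE : e = (complex.Re e)%:C%C by rewrite RRe_real // gtr0_real.
have e20 : 0 < complex.Re e / 2.
  by rewrite divr_gt0 //; move: e0; rewrite ltcE => /andP[].
near=> y; rewrite eE normC_normc ltcR.
apply: (le_lt_trans (normc_le_ReIm _)) => /=.
rewrite [ltRHS]splitr ltrD //; near: y.
  exact: (@cvgr_dist_lt _ _ _ _ _ _ _ (@cvg_fst _ _ (nbhs x.1) (nbhs x.2) _)).
exact: (@cvgr_dist_lt _ _ _ _ _ _ _ (@cvg_snd _ _ (nbhs x.1) (nbhs x.2) _)).
Unshelve. all: by end_near. Qed.

(** Tychonoff, with each complex coordinate ranging over the image of a real
    square. *)
Lemma compact_cube (M : R) :
  compact [set v : 'rV[R[i]]_n | forall k, `|crd k v| <= M].
Proof.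
pose S := (fun x : R * R => (x.1 +i* x.2)%C) @` (`[- M, M] `*` `[- M, M]).
have cS : compact S.
  apply: continuous_compact; last first.
    by apply: compact_setX; exact: segment_compact.
  by apply: continuous_subspaceT; exact: continuous_complex.
suff -> : [set v : 'rV[R[i]]_n | forall k, `|crd k v| <= M] =
    [set v | forall i : 'I_n, S (v ord0 i)].
  exact: (@rV_compact _ n (fun=> S)).
apply/seteqP; split=> v vM.
  move=> i; exists (complex.Re (v 0 i), complex.Im (v 0 i)); last by case: (v 0 i).
  have := vM (i, false); have := vM (i, true).
  by rewrite /crd /= !ler_norml => h1 h2; split; rewrite /= in_itv.
move=> k; have [x [+ + E]] := vM k.1; rewrite /crd -E /= !in_itv /= !ler_norml.
by case: k.2.
Qed.

Lemma compact_boundary D : bounded_set D -> compact (boundary D).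
Proof.
move=> /bounded_crd[M M0 DM].
have cb : closed (boundary D).
  apply: closedI; first exact: closed_closure.
  by apply: open_closedC; exact: open_interior.
apply: (subclosed_compact cb (@compact_cube (M + 1))) => q [cq _] k.
have [z [Dz qz]] := cq _ (box_nbhs q ltr01).
have h1 := DM z k Dz; have /ltW h2 := qz k.
rewrite (_ : crd k q = crd k z - crd k (z - q)); last by rewrite crdB; ring.
by apply: le_trans (ler_normB _ _) _; rewrite lerD.
Qed.

End BoundaryTopology.

(** * Pigeonhole, and finiteness away from the boundary *)
Section Pigeonhole.
Context {R : realType}.

(** Used to index the cells of a subdivision into unit intervals: a finite type
    of cells for the interval from 0 to X. *)
Lemma eq_inord_trunc_close (X x y : R) : 0 <= x <= X -> 0 <= y <= X ->
  inord (Num.trunc x) = inord (Num.trunc y) :> 'I_(Num.trunc X).+1 ->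
  `|x - y| <= 1.
Proof.
move=> /andP[x0 xX] /andP[y0 yX] /(congr1 val); rewrite /= !inordK ?ltnS ?le_truncn //.
have := truncn_itv x0; have := truncn_itv y0 => + + E; rewrite E -natr1.
by move=> /andP[a1 a2] /andP[a3 a4]; rewrite ler_norml; apply/andP; split; lra.
Qed.

Lemma eventually_false_of_inj_on (K : finType) (P : nat -> Prop) (f : nat -> K) :
  (forall i j, P i -> P j -> f i = f j -> i = j) ->
  exists N, forall j, (N <= j)%N -> ~ P j.
Proof.
move=> inj; pose g kappa := xget 0%N [set i | P i /\ f i = kappa].
exists (\max_(kappa : K) g kappa).+1 => j Nj Pj.
have : [set i | P i /\ f i = f j] j by [].
move=> /(xgetI 0%N)[Pg fg].
have gj : g (f j) = j by exact: inj.
by have := leq_bigmax (F := g) (f j); rewrite gj leqNgt Nj.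
Qed.

End Pigeonhole.

Section ComplexMultiples.
Context {R : realType} {n : nat}.
Implicit Types (z w q v : 'rV[R[i]]_n) (D : set 'rV[R[i]]_n).

Lemma onorm_cscale (c : R[i]) v : onorm (c *: v) <= 2 * Normc.normc c * onorm v.
Proof.
rewrite !onormE mulr_sumr; apply: ler_sum => j _.
have h b : `|crd (j, b) (c *: v)| <=
    Normc.normc c * (`|crd (j, false) v| + `|crd (j, true) v|).
  apply: (le_trans (crd_le_normc _ _)); rewrite mxE Normc.normcM /=.
  by rewrite ler_wpM2l ?normc_ge0 // normc_le_crd.
by have := h false; have := h true; lra.
Qed.

(** A point at distance a from the boundary is the centre of a ball of radius a
    in D, so two such points in one cube of a fixed fine grid span a flat disk
    in D; D meets finitely many cubes. *)
Lemma finitely_many_away_from_boundary D (x : nat -> 'rV[R[i]]_n) (lambda a : R) :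
  open D -> bounded_set D -> (forall j, D (x j)) -> 0 < lambda ->
  (forall j k, (forall c : R[i], Normc.normc c < lambda ->
     D (x j + c *: (x k - x j))) -> j = k) ->
  0 < a -> exists N, forall j, (N <= j)%N -> dist_boundary D (x j) < a.
Proof.
move=> oD bD Dx l0 sep a0; have [M M0 DM] := bounded_crd bD.
pose h := a / (2 * lambda * (n.*2%:R + 1)).
have h0 : 0 < h by rewrite divr_gt0 // !mulr_gt0 // ltr_wpDl.
pose X := 2 * M / h.
pose u j k : R := (crd k (x j) + M) / h.
have u01 j k : 0 <= u j k <= X.
  have := DM _ k (Dx j); rewrite ler_norml => /andP[a1 a2].
  rewrite /u /X divr_ge0 ?(ltW h0) //=; last by lra.
  by rewrite ler_pM2r ?invr_gt0 //; lra.
pose key j := [ffun k : 'I_n * bool => inord (Num.trunc (u j k)) : 'I_(Num.trunc X).+1].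
have [|N HN] := @eventually_false_of_inj_on _
    (fun j => a <= dist_boundary D (x j)) key; last first.
  by exists N => j /HN /negP; rewrite -ltNge.
move=> i j ai aj /ffunP E; apply: sep => c cl; apply: (dist_boundary_ball oD (Dx i)).
apply: lt_le_trans ai; rewrite onormB addrC addKr.
apply: (le_lt_trans (onorm_cscale _ _)).
have close : onorm (x j - x i) <= n.*2%:R * h.
  apply: onorm_le_const => k; have := E k; rewrite !ffunE => /eq_inord_trunc_close.
  move=> /(_ (u01 _ _) (u01 _ _)).
  rewrite /u -mulrBl (_ : _ + M - _ = crd k (x i) - crd k (x j)); last by ring.
  rewrite normrM [`|h^-1|]gtr0_norm ?invr_gt0 // ler_pdivrMr // mul1r.
  by rewrite -crdB crd_distC.
have -> : a = 2 * lambda * (n.*2%:R + 1) * h.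
  by rewrite /h mulrC divfK // gt_eqF // !mulr_gt0 // ltr_wpDl.
have c0 := normc_ge0 c; have m0 : 0 <= n.*2%:R :> R by [].
apply: (@le_lt_trans _ _ (2 * lambda * (n.*2%:R * h))).
  by apply: ler_pM => //; rewrite ?mulr_ge0 ?onorm_ge0 // ler_pM2l // ltW.
by rewrite mulrA ltr_pM2r // ltr_pM2l ?mulr_gt0 // ltrDl.
Qed.

End ComplexMultiples.

(** * Counting the points of a shell near a boundary point *)
Section RealForms.
Context {R : realType} {n : nat}.
Implicit Types (G H : 'I_n * bool -> R) (v w : 'rV[R[i]]_n).

(** For G the real gradient of r, these are the real and imaginary parts of the
    complex linear form v |-> 2 dr(v), whose coefficient on the j-th complex
    coordinate is G (j, false) - i G (j, true). *)
Definition re_form G v := \sum_k G k * crd k v.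
Definition im_form G v :=
  \sum_j (G (j, false) * crd (j, true) v - G (j, true) * crd (j, false) v).

Lemma re_form_cscale G (a : R[i]) v :
  re_form G (a *: v) = complex.Re a * re_form G v - complex.Im a * im_form G v.
Proof.
have E w : re_form G w =
    \sum_j (G (j, false) * crd (j, false) w + G (j, true) * crd (j, true) w).
  transitivity (\sum_j \sum_b G (j, b) * crd (j, b) w).
    by rewrite pair_bigA; apply: eq_bigr => -[].
  by apply: eq_bigr => j _; rewrite big_bool addrC.
rewrite !E /im_form !mulr_sumr -sumrB; apply: eq_bigr => j _.
by rewrite /crd !mxE /=; case: a (v 0 j) => [a1 a2] [v1 v2] /=; ring.
Qed.

Lemma im_formB G v w : im_form G (v - w) = im_form G v - im_form G w.
Proof. by rewrite /im_form -sumrB; apply: eq_bigr => j _; rewrite !crdB; ring. Qed.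

Lemma im_form_subl G H v :
  im_form G v - im_form H v = im_form (fun k => G k - H k) v.
Proof. by rewrite /im_form -sumrB; apply: eq_bigr => j _; ring. Qed.

Lemma im_form_le G (K : R) v : (forall k, `|G k| <= K) ->
  `|im_form G v| <= K * onorm v.
Proof.
move=> GK; rewrite (le_trans (ler_norm_sum _ _ _)) // onormE mulr_sumr.
apply: ler_sum => j _; apply: le_trans (ler_normB _ _) _.
by rewrite !normrM mulrDr addrC lerD // ler_wpM2r.
Qed.

End RealForms.

Section ShellCount.
Context {R : realType} {n : nat}.
Implicit Types (z w q v : 'rV[R[i]]_n) (D : set 'rV[R[i]]_n) (k : 'I_n * bool).
Context (D : set 'rV[R[i]]_n) (p : 'rV[R[i]]_n) (rho : R).
Context (r : 'rV[R[i]]_n -> R) (L c sigma : R) (e : 'I_n * bool).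
Context (chart : boundary_chart D p rho r L c sigma e).
Context (oD : open D) (bp : boundary D p).

Local Notation m := (n.*2%:R : R).

Let rho0 : 0 < rho := chart_rho chart.
Let L1 : 1 <= L := chart_L chart.
Let L0 : 0 <= L := le_trans ler01 L1.
Let c0 : 0 < c := chart_c chart.

Lemma box_half z : box p (rho / 2) z -> box p rho z.
Proof. by apply: box_sub; have := rho0; lra. Qed.

Lemma half_box_add z w : box p (rho / 2) z -> box z (rho / 2) w -> box p rho w.
Proof. by move=> zp zw; rewrite [rho]splitr; exact: box_trans zw. Qed.

(** The boundary point nearest to z has r >= 0, and r is Lipschitz. *)
Lemma defining_upper a z : 0 < a -> 2 * a <= rho / 2 -> D z ->
  box p (rho / 2) z -> dist_boundary D z <= a -> - r z <= 2 * m * L * a.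
Proof.
move=> a0 ar Dz zp da.
have [w bw zw] := @dist_boundary_adherent _ _ D z a (ex_intro _ p bp) a0.
have zw2 : euclidean_norm (z - w) < 2 * a by lra.
have wp : box p rho w.
  apply: (half_box_add zp) => k; rewrite crd_distC.
  by rewrite (le_lt_trans (crd_le_euclidean k _)) // (lt_le_trans zw2).
have rw : 0 <= r w.
  by rewrite leNgt; apply/negP => /(chart_domain chart wp); exact: boundary_not_in.
have zw1 : onorm (w - z) <= m * (2 * a).
  rewrite onormB; apply: onorm_le_const => k.
  exact: le_trans (crd_le_euclidean k _) (ltW zw2).
have := chart_lip chart (box_half zp) wp; rewrite ler_norml => /andP[_].
have : L * onorm (w - z) <= L * (m * (2 * a)) by rewrite ler_wpM2l.
by move=> h1 h2; lra.
Qed.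

Lemma onorm_move k t z : onorm (move k t z - z) = `|t|.
Proof.
rewrite /onorm (bigD1 k) //= big1 ?addr0 => [|l lk]; rewrite crdB crd_move.
  by rewrite eqxx addrC addKr.
by rewrite (negPf lk) addr0 subrr normr0.
Qed.

(** Moving from z by - r z / c in the transversal direction makes r nonnegative,
    hence leaves D and crosses the boundary on the way. *)
Lemma defining_lower z : D z -> box p (rho / 2) z -> - r z < c * (rho / 2) ->
  c * dist_boundary D z <= - r z.
Proof.
move=> Dz zp rz; have rz0 : r z < 0 by apply/(chart_domain chart (box_half zp)).
pose t := - r z / c; have t0 : 0 <= t by rewrite divr_ge0 ?ltW // oppr_gt0.
have tE : c * t = - r z by rewrite /t mulrC divfK ?gt_eqF.
have st : `|sigma * t| = t by rewrite normrM (chart_sigma chart) mul1r ger0_norm.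
set z' := move e (sigma * t) z.
have z'p : box p rho z'.
  apply: (half_box_add zp); apply: onorm_box; rewrite onorm_move st.
  by rewrite /t ltr_pdivrMr // mulrC.
have nD : ~ D z'.
  move=> /(chart_domain chart z'p).
  have := chart_transversal chart t0 (box_half zp) z'p; rewrite tE -/z'; lra.
have [q bq zq] := segment_meets_boundary oD Dz nD.
rewrite -tE ler_pM2l //; apply: le_trans (dist_boundary_le z bq) _.
apply: le_trans (euclidean_le_onorm _) _; apply: le_trans zq _.
by rewrite onormB onorm_move st.
Qed.

Lemma transversal_abs z t : box p rho z -> box p rho (move e t z) ->
  c * `|t| <= `|r (move e t z) - r z|.
Proof.
move=> zp; have s1 := chart_sigma chart.
have ss : sigma * sigma = 1.
  by rewrite -expr2 -(real_normK (num_real sigma)) s1 expr1n.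
have [u ->] : exists u, t = sigma * u by exists (sigma * t); rewrite mulrA ss mul1r.
rewrite normrM s1 mul1r => tp; have [u0|/ltW u0] := lerP 0 u.
  by rewrite ger0_norm // (le_trans (chart_transversal chart u0 zp tp)) // ler_norm.
have E : move e (sigma * - u) (move e (sigma * u) z) = z.
  by rewrite move_move mulrN subrr move0.
have := @chart_transversal _ _ _ _ _ _ _ _ _ _ chart (move e (sigma * u) z) (- u).
rewrite E oppr_ge0 => /(_ u0 tp zp) h.
by rewrite ler0_norm // (le_trans h) // distrC ler_norm.
Qed.

Definition cell_spread := m * (1 + (1 + L * m) / c).

(** The values of r and of all the coordinates but e determine the coordinate e,
    since r varies at rate at least c along e. *)
Lemma cell_diameter h z w : 0 <= h -> box p (rho / 2) z -> box p (rho / 2) w ->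
  (forall k, k != e -> `|crd k (w - z)| <= h) -> `|r w - r z| <= h ->
  onorm (w - z) <= cell_spread * h.
Proof.
move=> h0 zp wp close rclose; set t := crd e (w - z); set y := move e t z.
have yE l : crd l y = if l == e then crd l w else crd l z.
  rewrite /y crd_move /t; case: eqP => [->|_]; last exact: addr0.
  by rewrite crdB addrC subrK.
have yp : box p rho y.
  by apply: box_half => l; rewrite crdB yE; case: eqP => _; rewrite -crdB.
have wy : onorm (w - y) <= m * h.
  apply: onorm_le_const => l; rewrite crdB yE.
  by case: eqP => [_|/eqP le]; [rewrite subrr normr0 | rewrite -crdB close].
have ry : `|r w - r y| <= L * (m * h).
  by rewrite (le_trans (chart_lip chart yp (box_half wp))) // ler_wpM2l.
have ct : c * `|t| <= (1 + L * m) * h.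
  apply: le_trans (transversal_abs (box_half zp) yp) _.
  rewrite -/y (_ : r y - r z = (r w - r z) - (r w - r y)); last ring.
  by apply: le_trans (ler_normB _ _) _; lra.
have tle : `|t| <= (1 + L * m) / c * h.
  by rewrite mulrAC ler_pdivlMr // mulrC.
rewrite /cell_spread -mulrA; apply: onorm_le_const => k.
have [->|ke] := eqVneq k e.
  by rewrite -/t (le_trans tle) // ler_wpM2r // lerDr.
have /le_trans := close k ke; apply; rewrite mulrDl mul1r lerDl mulr_ge0 //.
by rewrite divr_ge0 ?(ltW c0) // addr_ge0 // mulr_ge0.
Qed.

Definition gradient q k := partial k.1 k.2 r q.

Lemma im_gradient_bound q v : box p rho q -> `|im_form (gradient q) v| <= L * onorm v.
Proof. by move=> qp; apply: im_form_le => k; exact: (chart_grad_le chart). Qed.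

Lemma im_gradient_lip q z v : box p rho q -> box p rho z ->
  `|im_form (gradient z) v - im_form (gradient q) v| <= L * onorm (z - q) * onorm v.
Proof.
move=> qp zp; rewrite im_form_subl; apply: im_form_le => k.
exact: (chart_grad_lip chart).
Qed.

(** Complex multiples of v rotate the real part of dr(z) v into its imaginary
    part, so both must be small compared with - r z; the quadratic term of the
    Taylor formula only asks for v to be small compared with its square
    root. *)
Lemma linear_disk_in_domain lambda tau1 tau2 kappa z v : 0 <= lambda ->
  box p (rho / 2) z ->
  `|re_form (gradient z) v| <= tau1 -> `|im_form (gradient z) v| <= tau2 ->
  onorm v <= kappa ->
  2 * lambda * kappa < rho / 2 ->
  lambda * (tau1 + tau2) + L * (2 * lambda * kappa) ^+ 2 < - r z ->
  forall a : R[i], Normc.normc a < lambda -> D (z + a *: v).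
Proof.
move=> l0 zp t1 t2 vk kr neg a al; have a0 := normc_ge0 a.
have av : onorm (a *: v) <= 2 * lambda * kappa.
  apply: (le_trans (onorm_cscale _ _)).
  by apply: ler_pM => //; rewrite ?mulr_ge0 ?onorm_ge0 // ler_pM2l // ltW.
have zz : z + a *: v - z = a *: v by rewrite addrC addKr.
have wp : box p rho (z + a *: v).
  by apply: (half_box_add zp); apply: onorm_box; rewrite zz (le_lt_trans av).
apply/(chart_domain chart wp).
have : `|r (z + a *: v) - r z - re_form (gradient z) (a *: v)|
    <= L * onorm (a *: v) ^+ 2.
  rewrite -[X in onorm X]zz -[X in re_form _ X]zz.
  by apply: (chart_taylor chart) => //; exact: box_half.
rewrite ler_norml => /andP[_].
have : re_form (gradient z) (a *: v) <= lambda * (tau1 + tau2).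
  rewrite re_form_cscale (le_trans (ler_norm _)) // (le_trans (ler_normB _ _)) //.
  rewrite !normrM mulrDr lerD // ler_pM //.
    exact: le_trans (Re_le_normc a) (ltW al).
  exact: le_trans (Im_le_normc a) (ltW al).
have : L * onorm (a *: v) ^+ 2 <= L * (2 * lambda * kappa) ^+ 2.
  by rewrite ler_wpM2l // ler_sqr ?nnegrE ?onorm_ge0 // (le_trans (onorm_ge0 _) av).
move: neg.
generalize (re_form (gradient z) (a *: v)) (r (z + a *: v)) (r z)
  (L * onorm (a *: v) ^+ 2) (L * (2 * lambda * kappa) ^+ 2).
by move=> *; lra.
Qed.

End ShellCount.

Section ShellCountBound.
Context {R : realType} {n : nat}.
Implicit Types (z w q v : 'rV[R[i]]_n) (D : set 'rV[R[i]]_n).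

(** The lower bound s^2 / 4, rather than s^2 / e, keeps the exponential out of
    the geometric part. *)
Definition shell_indices D (x : nat -> 'rV[R[i]]_n) (A : set 'rV[R[i]]_n)
    (s : R) N : {set 'I_N} :=
  [set j : 'I_N | `[< A (x j) /\ s ^+ 2 / 4 <= dist_boundary D (x j) <= s ^+ 2 >]].

Lemma small_factor (X Y a b : R) : 0 <= X -> 0 <= Y -> 0 < a -> 0 < b ->
  exists2 eta, 0 < eta <= 1 & eta * X < a /\ eta * Y < b.
Proof.
move=> X0 Y0 a0 b0; have X1 : 0 < X + 1 by rewrite ltr_wpDl.
have Y1 : 0 < Y + 1 by rewrite ltr_wpDl.
pose eta := Num.min 1 (Num.min (a / (X + 1)) (b / (Y + 1))).
have e0 : 0 < eta by rewrite !lt_min ltr01 !divr_gt0.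
have [eX eY] : eta <= a / (X + 1) /\ eta <= b / (Y + 1).
  by split; rewrite /eta !ge_min lexx !orbT.
exists eta; first by rewrite e0 ge_min lexx.
by move: eX eY; rewrite !ler_pdivlMr // => eX eY; split; nra.
Qed.

(** Points of the shell of scale s near p have pairwise distinct cells, and there
    are O(s^(- 2n)) cells. *)
Lemma shell_count D (x : nat -> 'rV[R[i]]_n) (lambda : R)
    p rho r (L c sigma : R) e :
  open D -> (forall j, D (x j)) -> 0 < lambda ->
  (forall j k, (forall a : R[i], Normc.normc a < lambda ->
     D (x j + a *: (x k - x j))) -> j = k) ->
  boundary D p -> boundary_chart D p rho r L c sigma e ->
  exists C s0, [/\ 0 <= C, 0 < s0 <= 1 & forall s N, 0 < s <= s0 ->
    #|shell_indices D x (box p (rho / 2)) s N|%:R <= C / s ^+ n.*2].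
Proof.
move=> oD Dx l0 sep bp chart.
have rho0 := chart_rho chart; have c0 := chart_c chart.
have L0 : 0 <= L := le_trans ler01 (chart_L chart).
pose m : R := n.*2%:R; have m0 : 0 <= m by [].
have [K K0 diam] : exists2 K : R, 0 <= K &
    forall h z w, 0 <= h -> box p (rho / 2) z -> box p (rho / 2) w ->
    (forall k, k != e -> `|crd k (w - z)| <= h) -> `|r w - r z| <= h ->
    onorm (w - z) <= K * h.
  exists (cell_spread (n := n) L c); last exact: (cell_diameter chart).
  by rewrite mulr_ge0 // addr_ge0 // divr_ge0 ?(ltW c0) // addr_ge0 // mulr_ge0.
(* In a cell of mesh eta, both parts of the form 2 dr(z) v are at most
   tau eta s^2. *)
pose tau := 1 + L * K ^+ 2.
have tau0 : 0 <= tau by rewrite /tau addr_ge0 // mulr_ge0 // sqr_ge0.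
(* The disk through two points of one cell stays in D if eta X < c / 4, by the
   Taylor estimate, and if eta Y < rho / 2, so that it stays in the box. *)
pose X := lambda * (tau + tau) + L * (2 * lambda * K) ^+ 2.
have l0' := ltW l0.
have X0 : 0 <= X.
  apply: addr_ge0; apply: mulr_ge0 => //; last exact: sqr_ge0.
  exact: addr_ge0.
pose Y := 2 * lambda * K.
have Y0 : 0 <= Y by rewrite /Y !mulr_ge0.
have [eta /andP[eta0 eta1] [etaX etaY]] : exists2 eta, 0 < eta <= 1 &
    eta * X < c / 4 /\ eta * Y < rho / 2.
  by apply: small_factor; rewrite ?divr_gt0.
pose C1 := 2 * m * L; have C10 : 0 <= C1 by rewrite /C1 !mulr_ge0.
have [s0 /andP[s00 s01] [s0r s0c]] : exists2 s0, 0 < s0 <= 1 &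
    s0 * 2 < rho / 2 /\ s0 * C1 < c * (rho / 2).
  by apply: small_factor; rewrite ?mulr_gt0 ?divr_gt0.
(* B / s bounds the number of pieces of every coordinate of mesh eta s. *)
pose B := rho / eta + 2 * L * K.
have B0 : 0 <= B.
  by apply: addr_ge0; [apply: divr_ge0; exact: ltW | rewrite !mulr_ge0].
pose M' := Num.trunc (C1 / eta).
exists ((B + 1) ^+ n.*2 * M'.+1%:R), s0; split.
- by rewrite mulr_ge0 // exprn_ge0 // addr_ge0.
- by rewrite s00.
move=> s N /andP[sp ss0].
have s1 : s <= 1 := le_trans ss0 s01.
have s2p : 0 < s ^+ 2 by rewrite exprn_gt0.
have s2s : s ^+ 2 <= s by rewrite expr2 ler_piMl // ltW.
set S := shell_indices _ _ _ _ _.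
have SP (j : 'I_N) : j \in S -> [/\ box p (rho / 2) (x j), box p rho (x j),
    0 <= - r (x j) <= C1 * s ^+ 2 & c * (s ^+ 2 / 4) <= - r (x j)].
  rewrite inE => /asboolP[xp /andP[d1 d2]].
  have xr := box_half chart xp.
  have up : - r (x j) <= C1 * s ^+ 2.
    by apply: (defining_upper chart oD bp) => //; nra.
  split=> //.
    rewrite up andbT oppr_ge0 ltW //; apply/(chart_domain chart xr).
    exact: Dx.
  have lo : c * dist_boundary D (x j) <= - r (x j).
    apply: (defining_lower chart oD) => //.
    apply: (le_lt_trans up); apply: le_lt_trans s0c.
    by rewrite mulrC ler_wpM2r // (le_trans s2s).
  by apply: le_trans lo; rewrite ler_pM2l.
pose M := Num.trunc (B / s).
(* Normalized coordinates: position of the k-th one in units of eta s. *)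
pose u j k : R := (crd k (x j - p) + rho / 2) / (eta * s).
have es0 : 0 < eta * s by rewrite mulr_gt0.
have u01 j k : j \in S -> 0 <= u j k <= B / s.
  move=> /SP[/(_ k)]; rewrite ltr_norml => /andP[/ltW a1 /ltW a2] _ _ _.
  apply/andP; split; first by rewrite /u divr_ge0 ?(ltW es0) //; lra.
  rewrite /u invfM mulrA ler_pM2r ?invr_gt0 //.
  apply: (@le_trans _ _ (rho / eta)); last by rewrite /B lerDl !mulr_ge0.
  by rewrite ler_pM2r ?invr_gt0 //; lra.
pose ur j : R := - r (x j) / (eta * s ^+ 2).
have es20 : 0 < eta * s ^+ 2 by rewrite mulr_gt0.
have ur01 j : j \in S -> 0 <= ur j <= C1 / eta.
  move=> /SP[_ _ /andP[a1 a2] _]; rewrite /ur divr_ge0 ?(ltW es20) //=.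
  by rewrite ler_pdivrMr // mulrA divfK // gt_eqF.
(* The coarse cell forgets the coordinate e; the constant entry ord0 there leaves
   room for the imaginary part in the final cell. *)
pose cell1 (j : 'I_N) : {ffun 'I_n * bool -> 'I_M.+1} * 'I_M'.+1 :=
  ([ffun k => if k == e then ord0 else inord (Num.trunc (u j k))],
   inord (Num.trunc (ur j))).
have close i j : i \in S -> j \in S -> cell1 i = cell1 j ->
    [/\ onorm (x j - x i) <= K * (eta * s) & `|r (x j) - r (x i)| <= eta * s ^+ 2].
  move=> Si Sj E.
  have rc : `|r (x j) - r (x i)| <= eta * s ^+ 2.
    have := congr1 snd E => /(eq_inord_trunc_close (ur01 _ Si) (ur01 _ Sj)).
    rewrite /ur -mulrBl opprK addrC normrM [`|_^-1|]gtr0_norm ?invr_gt0 //.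
    by rewrite ler_pdivrMr // mul1r.
  split=> //.
  have [xpi _ _ _] := SP i Si; have [xpj _ _ _] := SP j Sj.
  apply: diam => //; first exact: ltW.
    move=> k ke; have /ffunP/(_ k) := congr1 fst E; rewrite /= !ffunE (negPf ke).
    move=> /(eq_inord_trunc_close (u01 _ _ Si) (u01 _ _ Sj)).
    rewrite /u -mulrBl !crdB.
    rewrite (_ : _ + rho / 2 - _ = - (crd k (x j) - crd k (x i))); last by ring.
    by rewrite normrM normrN [`|_^-1|]gtr0_norm ?invr_gt0 // ler_pdivrMr // mul1r -crdB.
  by apply: (le_trans rc); rewrite ler_pM2l.
(* A point depending only on the coarse cell of x j. *)
pose base j : 'I_N := odflt j [pick i in S | cell1 i == cell1 j].
have baseP j : j \in S -> base j \in S /\ cell1 (base j) = cell1 j.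
  move=> Sj; rewrite /base; case: pickP => [i /andP[Si /eqP]|/(_ j)] //=.
have base_eq i j : i \in S -> cell1 i = cell1 j -> base i = base j.
  move=> Si E; rewrite /base -E; case: pickP => [//|/(_ i)].
  by rewrite Si eqxx.
pose G j := im_form (gradient r (x (base j))).
pose ui (j : 'I_N) : R :=
  (G j (x j - x (base j)) + L * (K * (eta * s))) / (eta * s ^+ 2).
have ui01 j : j \in S -> 0 <= ui j <= B / s.
  move=> Sj; have [Sb Eb] := baseP j Sj; have [xb _] := close _ _ Sb Sj Eb.
  have [_ pb _ _] := SP _ Sb.
  have : `|G j (x j - x (base j))| <= L * (K * (eta * s)).
    by rewrite (le_trans (im_gradient_bound chart _ pb)) // ler_wpM2l.
  rewrite /ui; move: (G j _) => y; rewrite ler_norml => /andP[y1 y2].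
  rewrite divr_ge0 ?(ltW es20) //=; last by lra.
  rewrite ler_pdivrMr // (_ : B / s * (eta * s ^+ 2) = rho * s + 2 * L * K * (eta * s)).
    by have := mulr_ge0 (ltW rho0) (ltW sp); lra.
  by rewrite /B; field; rewrite !gt_eqF.
pose cell (j : 'I_N) : {ffun 'I_n * bool -> 'I_M.+1} * 'I_M'.+1 :=
  ([ffun k => if k == e then inord (Num.trunc (ui j)) else inord (Num.trunc (u j k))],
   inord (Num.trunc (ur j))).
(* Two points of one cell span a flat disk in D, so they are equal. *)
have cell_inj : {in S &, injective cell}.
  move=> i j Si Sj E.
  have E1 : cell1 i = cell1 j.
    congr pair; last by have := congr1 snd E.
    apply/ffunP => k; have /ffunP/(_ k) := congr1 fst E; rewrite /= !ffunE.
    by case: eqP.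
  have bij := base_eq i j Si E1; have [vK rv] := close _ _ Si Sj E1.
  have [xpi xri rri clo] := SP i Si; have [xpj xrj _ _] := SP j Sj.
  have [Sb Eb] := baseP i Si; have [xb _] := close _ _ Sb Si Eb.
  have [_ pb _ _] := SP _ Sb.
  apply: val_inj; apply: sep; set v := x j - x i.
  have K2 : L * (K * (eta * s)) ^+ 2 <= L * K ^+ 2 * (eta * s ^+ 2).
    rewrite -mulrA ler_wpM2l // exprMn ler_wpM2l ?sqr_ge0 // exprMn.
    by rewrite ler_pM2r // expr2 ler_piMl // ltW.
  have Rev : `|re_form (gradient r (x i)) v| <= tau * (eta * s ^+ 2).
    have t : `|r (x j) - r (x i) - re_form (gradient r (x i)) v|
        <= L * onorm v ^+ 2 by apply: (chart_taylor chart).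
    have t2 : L * onorm v ^+ 2 <= L * (K * (eta * s)) ^+ 2.
      by rewrite ler_wpM2l // ler_sqr ?nnegrE ?onorm_ge0 // (le_trans (onorm_ge0 _) vK).
    move: t t2 K2 rv; rewrite /tau !ler_norml.
    generalize (re_form (gradient r (x i)) v) (r (x j) - r (x i)) (L * onorm v ^+ 2)
      (L * (K * (eta * s)) ^+ 2) => A b d f.
    by move=> /andP[? ?] ? ? /andP[? ?]; apply/andP; split; lra.
  have Imv : `|im_form (gradient r (x i)) v| <= tau * (eta * s ^+ 2).
    have Gv : `|G i v| <= eta * s ^+ 2.
      have /ffunP/(_ e) := congr1 fst E; rewrite /= !ffunE eqxx.
      move=> /(eq_inord_trunc_close (ui01 _ Si) (ui01 _ Sj)).
      rewrite /ui -mulrBl normrM [`|_^-1|]gtr0_norm ?invr_gt0 // ler_pdivrMr // mul1r.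
      have vE : v = (x j - x (base i)) - (x i - x (base i)).
        by rewrite /v opprB addrA subrK.
      apply: le_trans; rewrite vE /G -bij im_formB.
      generalize (im_form (gradient r (x (base i))) (x j - x (base i))).
      generalize (im_form (gradient r (x (base i))) (x i - x (base i))) => A b.
      by rewrite distrC opprD addrACA subrr addr0.
    have lip := im_gradient_lip chart v pb xri.
    have lip2 : L * onorm (x i - x (base i)) * onorm v <= L * (K * (eta * s)) ^+ 2.
      by rewrite -mulrA ler_wpM2l // expr2 ler_pM ?onorm_ge0.
    move: Gv lip lip2 K2; rewrite /tau /G !ler_norml.
    generalize (im_form (gradient r (x i)) v) (im_form (gradient r (x (base i))) v)
      (L * onorm (x i - x (base i)) * onorm v) (L * (K * (eta * s)) ^+ 2) => A b d f.
    by move=> /andP[? ?] /andP[? ?] ? ?; apply/andP; split; lra.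
  apply: (linear_disk_in_domain chart _ xpi Rev Imv vK); first exact: ltW.
    apply: le_lt_trans etaY; rewrite mulrA -/Y [eta * Y]mulrC mulrA.
    by rewrite ler_piMr // mulr_ge0 // ltW.
  apply: lt_le_trans clo.
  have -> : lambda * (tau * (eta * s ^+ 2) + tau * (eta * s ^+ 2)) =
      lambda * (tau + tau) * (eta * s ^+ 2) by ring.
  have : L * (2 * lambda * (K * (eta * s))) ^+ 2 <=
      L * (2 * lambda * K) ^+ 2 * (eta * s ^+ 2).
    rewrite -[leRHS]mulrA ler_wpM2l // [X in X ^+ 2]mulrA exprMn.
    rewrite ler_wpM2l ?sqr_ge0 // exprMn.
    by rewrite ler_pM2r // expr2 ler_piMl // ltW.
  rewrite -/Y => h.
  have : eta * X * s ^+ 2 < c / 4 * s ^+ 2 by rewrite ltr_pM2r.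
  move: h; rewrite /X -/Y; generalize (L * Y ^+ 2) => A h1 h2.
  have -> : c * (s ^+ 2 / 4) = c / 4 * s ^+ 2 by ring.
  apply: le_lt_trans h2.
  have -> : eta * (lambda * (tau + tau) + A) * s ^+ 2 =
    lambda * (tau + tau) * (eta * s ^+ 2) + A * (eta * s ^+ 2) by ring.
  by rewrite lerD2l; exact: h1.
have MB : M.+1%:R <= (B + 1) / s.
  rewrite -natr1 mulrDl lerD //.
    by rewrite truncn_le divr_ge0 // ltW.
  by rewrite mul1r invf_ge1.
apply: (@le_trans _ _ ((M.+1 ^ n.*2 * M'.+1)%N%:R)).
  rewrite ler_nat -(card_in_imset cell_inj) (leq_trans (max_card _)) //.
  by rewrite card_prod card_ffun card_prod !card_ord card_bool muln2.
rewrite natrM natrX [leRHS]mulrAC ler_wpM2r // -expr_div_n.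
by rewrite lerXn2r ?nnegrE //; apply: divr_ge0; [apply: addr_ge0 | apply: ltW].
Qed.

End ShellCountBound.

(** * Uniformity along the compact boundary *)
Section Covering.
Context {R : realType} {n : nat}.
Implicit Types (z w q p : 'rV[R[i]]_n) (A B : set 'rV[R[i]]_n).
Context (D : set 'rV[R[i]]_n) (x : nat -> 'rV[R[i]]_n).

Definition few_in_shells A := exists C s0, [/\ 0 <= C, 0 < s0 <= 1 &
  forall s N, 0 < s <= s0 ->
    #|shell_indices D x A s N|%:R <= C / s ^+ n.*2].

Lemma few_in_shells0 : few_in_shells set0.
Proof.
exists 0, 1; split; rewrite ?lexx ?ltr01 // => s N _.
rewrite mul0r (_ : shell_indices _ _ _ _ _ = finset.set0) ?cards0 //.
by apply/setP => j; rewrite !inE; apply/asboolP => -[].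
Qed.

Lemma few_in_shellsU A B :
  few_in_shells A -> few_in_shells B -> few_in_shells (A `|` B).
Proof.
move=> [C [s [C0 /andP[s0 s1] HA]]] [C' [s' [C'0 /andP[s'0 s'1] HB]]].
exists (C + C'), (Num.min s s'); split; first exact: addr_ge0.
  by rewrite lt_min s0 s'0 ge_min s1.
move=> t N /andP[t0]; rewrite le_min => /andP[ts ts'].
rewrite mulrDl; apply: le_trans (lerD (HA t N _) (HB t N _)); rewrite ?t0 //.
rewrite -natrD ler_nat; apply: leq_trans (leq_card_setU _ _).
apply: subset_leq_card; apply/fintype.subsetP => j; rewrite !inE.
move=> [AB dj]; apply/orP.
by case: AB => h; [left | right]; apply/asboolP.
Qed.

Context (few_locally : forall p, boundary D p ->
  exists2 rho, 0 < rho & few_in_shells (box p (rho / 2))).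

Lemma few_near_finite_union (rho : 'rV[R[i]]_n -> R) (s : seq 'rV[R[i]]_n) :
  (forall p, p \in s -> 0 < rho p /\ few_in_shells (box p (rho p / 2))) ->
  exists W t, [/\ few_in_shells W, 0 < t & forall p q, p \in s ->
    box p (rho p / 4) q -> box q t `<=` W].
Proof.
elim: s => [_|p s IH h].
  by exists set0, 1; split => //; exact: few_in_shells0.
have [|W [t [fW t0 HW]]] := IH; first by move=> q qs; apply: h; rewrite inE qs orbT.
have [r0 fr] := h p (mem_head _ _).
exists (W `|` box p (rho p / 2)), (Num.min t (rho p / 4)); split.
- exact: few_in_shellsU.
- by rewrite lt_min t0 divr_gt0.
- move=> q y; rewrite inE => /orP[/eqP->|qs] qy z yz.
    right; have -> : rho p / 2 = rho p / 4 + rho p / 4 by field.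
    by apply: box_trans qy (box_sub _ yz); rewrite ge_min lexx orbT.
  by left; apply: (HW _ _ qs qy); apply: (box_sub _ yz); rewrite ge_min lexx.
Qed.

(** A Lebesgue number argument: radii are halved twice so that boxes of radius t
    around all boundary points lie in finitely many good boxes. *)
Lemma few_near_boundary : bounded_set D -> exists W t,
  [/\ few_in_shells W, 0 < t & forall q, boundary D q -> box q t `<=` W].
Proof.
move=> /compact_boundary; rewrite compact_cover => cov.
pose rho p := xget 0 [set rho : R | 0 < rho /\ few_in_shells (box p (rho / 2))].
have rhoP p : boundary D p -> 0 < rho p /\ few_in_shells (box p (rho p / 2)).
  move=> /few_locally[t t0 ft].
  have h : [set rho : R | 0 < rho /\ few_in_shells (box p (rho / 2))] t by [].
  exact: (xgetI 0 h).
have [||D' D'b D'cov] := cov _ (boundary D) (fun p => interior (box p (rho p / 4))).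
- by move=> p _; exact: open_interior.
- move=> p bp; exists p => //; apply: box_nbhs.
  by rewrite divr_gt0 //; case: (rhoP _ bp).
have [|W [t [fW t0 HW]]] := @few_near_finite_union rho (finmap.enum_fset D').
  by move=> p /D'b; rewrite inE => /rhoP.
exists W, t; split=> // q bq; have [p pD' /interior_subset qp] := D'cov q bq.
exact: HW qp.
Qed.

Lemma few_in_all_shells : bounded_set D -> boundary D !=set0 ->
  few_in_shells setT.
Proof.
move=> /few_near_boundary[W [t [[C [s0 [C0 /andP[s00 s01] HC]]] t0 HW]]] b0.
have t20 : 0 < t / 2 by rewrite divr_gt0.
exists C, (Num.min s0 (t / 2)); split=> //.
  by rewrite lt_min s00 t20 ge_min s01.
move=> s N /andP[sp]; rewrite le_min => /andP[ss st].
apply: le_trans (HC s N _); last by rewrite sp.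
rewrite ler_nat; apply: subset_leq_card; apply/fintype.subsetP => j; rewrite !inE.
move=> [_ dj]; split=> //.
have [q bq zq] := dist_boundary_adherent (x j) b0 t20.
apply: (HW q bq) => k; rewrite (le_lt_trans (crd_le_euclidean k _)) //.
apply: (lt_le_trans zq); rewrite [leRHS]splitr lerD2r.
case/andP: dj => _ /le_trans; apply; apply: le_trans st.
by rewrite expr2 ler_piMl ?(ltW sp) // (le_trans ss).
Qed.

End Covering.

(** * Summation over the shells *)
Section Summation.
Context {R : realType} {n : nat}.
Context (D : set 'rV[R[i]]_n) (x : nat -> 'rV[R[i]]_n) (h : R -> R).
Context (h_ge0 : forall t, 0 <= t -> 0 <= h t).
Context (h_mono : forall s t, 0 <= s -> s <= t -> h s <= h t).

Local Notation d j := (dist_boundary D (x j)).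
Local Notation term j := (d j ^+ n * h (- (1 / ln (d j)))).

(** The scale s of the shell s^2 = exp (- m). *)
Let radius m : R := expR (- (m%:R / 2)).

Lemma radius_sqr m : radius m ^+ 2 = expR (- m%:R).
Proof. by rewrite /radius expr2 -expRD; congr expR; field. Qed.

Lemma radius_sqr_succ m : radius m ^+ 2 / 4 <= radius m.+1 ^+ 2.
Proof.
(* e <= 4 because exp (- 1/2) >= 1 - 1/2. *)
have e2 : 1 / 2 <= expR (- (1 / 2)) :> R.
  by have := expR_ge1Dx (- (1 / 2) : R); lra.
rewrite !radius_sqr -[m.+1%:R]natr1 opprD expRD ler_wpM2l ?expR_ge0 //.
rewrite (_ : - 1 = - (1 / 2) + - (1 / 2)); last by field.
by rewrite expRD; apply: le_trans (ler_pM _ _ e2 e2); lra.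
Qed.

Definition shell_of j := Num.trunc (- ln (d j)).

Lemma shell_ofP j : 0 < d j < 1 ->
  radius (shell_of j) ^+ 2 / 4 <= d j <= radius (shell_of j) ^+ 2.
Proof.
move=> /andP[d0 d1]; have nl : 0 <= - ln (d j) by rewrite oppr_ge0 ltW // ln_lt0 // d0.
have /andP[m1 m2] := truncn_itv nl; rewrite -/(shell_of j) in m1 m2.
have dE : d j = expR (- - ln (d j)) by rewrite opprK lnK.
apply/andP; split; last by rewrite radius_sqr dE ler_expR lerN2.
apply: le_trans (radius_sqr_succ _) _.
by rewrite radius_sqr dE ler_expR lerN2 ltW.
Qed.

Lemma term_le_shell j : 0 < d j < 1 -> (0 < shell_of j)%N ->
  term j <= radius (shell_of j) ^+ n.*2 * h (1 / (shell_of j)%:R).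
Proof.
move=> d01 m0; have /andP[_ dr] := shell_ofP d01; case/andP: d01 => d0 d1.
have nl : 0 < - ln (d j) by rewrite oppr_gt0 ln_lt0 // d0.
have /andP[m1 _] := truncn_itv (ltW nl).
have tE : - (1 / ln (d j)) = 1 / - ln (d j) by rewrite !mul1r invrN.
have t0 : 0 <= - (1 / ln (d j)) by rewrite tE divr_ge0 // ltW.
rewrite -muln2 mulnC exprM; apply: ler_pM.
- by rewrite exprn_ge0 // ltW.
- exact: h_ge0.
- by rewrite lerXn2r // nnegrE ?sqr_ge0 // ltW.
- by apply: h_mono => //; rewrite tE !mul1r lef_pV2 // posrE ltr0n.
Qed.

(** Beyond some index N0 all points lie in shells m >= m0 thin enough for the
    counting bound; grouping by shell, the count C radius^(- 2n) cancels the
    factor radius^(2n). *)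
Lemma summable_of_few_in_shells :
  (forall j, 0 < d j < 1) ->
  (forall a, 0 < a -> exists N, forall j, (N <= j)%N -> d j < a) ->
  few_in_shells D x setT ->
  (\sum_(1 <= m <oo) (h (1 / m%:R))%:E < +oo)%E ->
  (\sum_(0 <= j <oo) (term j)%:E < +oo)%E.
Proof.
move=> d01 away [C [s0 [C0 /andP[s00 s01] HC]]] hsum.
have hm0 m : 0 <= h (1 / m%:R) by rewrite h_ge0 // divr_ge0.
have [H HP] : exists H, forall k, \sum_(1 <= m < k) h (1 / m%:R) <= H.
  exists (fine (\sum_(1 <= m <oo) (h (1 / m%:R))%:E)%E) => k.
  rewrite -lee_fin fineK; last first.
    by rewrite ge0_fin_numE // nneseries_ge0 // => m _ _; rewrite lee_fin.
  by rewrite -sumEFin; apply: nneseries_lim_ge => m _ _; rewrite lee_fin.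
have term0 j : 0 <= term j.
  have /andP[d0 d1] := d01 j; rewrite mulr_ge0 ?exprn_ge0 ?(ltW d0) // h_ge0 //.
  by rewrite oppr_ge0 mul1r invr_le0 ltW // ln_lt0 // d0.
pose m0 := (Num.trunc (- 2 * ln s0)).+1.
have rs m : (m0 <= m)%N -> 0 < radius m <= s0.
  move=> m0m; rewrite expR_gt0 /= -[leRHS]lnK // ler_expR.
  have : - 2 * ln s0 < m0%:R := truncnS_gt _.
  have : m0%:R <= m%:R :> R by rewrite ler_nat.
  by move=> h1 h2; lra.
have [N0 HN0] := away _ (expR_gt0 (- m0%:R)).
have shell_ge j : (N0 <= j)%N -> (m0 <= shell_of j)%N.
  move=> /HN0 dj; have /andP[d0 d1] := d01 j.
  rewrite /shell_of truncn_ge_nat; last by rewrite oppr_ge0 ltW // ln_lt0 // d0.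
  by rewrite lerNr -[leRHS]expRK ler_ln ?posrE ?expR_gt0 // ltW.
have tail N : \sum_(N0 <= j < N) term j <= C * H.
  rewrite big_geq_mkord /=.
  apply: (@le_trans _ _ (\sum_(j < N | (N0 <= j)%N)
      radius (shell_of j) ^+ n.*2 * h (1 / (shell_of j)%:R))).
    apply: ler_sum => j /shell_ge mj; apply: term_le_shell => //.
    exact: leq_trans mj.
  pose T := (\max_(j < N) shell_of j).+1.
  have sT (j : 'I_N) : (shell_of j < T)%N.
    by rewrite ltnS (leq_bigmax (F := fun j : 'I_N => shell_of j)).
  rewrite (partition_big (fun j : 'I_N => Ordinal (sT j))
                         (fun m : 'I_T => (1 <= m)%N)) /=; last first.
    by move=> j /shell_ge; exact: leq_trans.
  apply: (@le_trans _ _ (\sum_(m < T | (1 <= m)%N) C * h (1 / m%:R))); last first.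
    rewrite -mulr_sumr ler_wpM2l //.
    by rewrite -(big_geq_mkord _ _ xpredT (fun m => h (1 / m%:R))).
  apply: ler_sum => m m1.
  rewrite (eq_bigr (fun=> radius m ^+ n.*2 * h (1 / m%:R))); last first.
    by move=> j /andP[_ /eqP <-].
  have rm0 : 0 < radius m ^+ n.*2 by rewrite exprn_gt0 // expR_gt0.
  have [m0m|mm0] := leqP m0 m; last first.
    rewrite big_pred0 ?mulr_ge0 // => j; apply/negP => /andP[/shell_ge mj /eqP E].
    by move: mm0; rewrite -E /= ltnNge mj.
  rewrite sumr_const -[X in X <= _]mulr_natl mulrA ler_wpM2r //.
  have := HC _ N (rs _ m0m); rewrite -ler_pdivrMr ?invr_gt0 // invrK => HCm.
  apply: le_trans HCm; rewrite ler_pM2r // ler_nat; apply: subset_leq_card.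
  apply/fintype.subsetP => j; rewrite !inE => /andP[_ /eqP E].
  have := shell_ofP (d01 j); rewrite -E /= => hj; by split.
rewrite (nneseries_split 0 N0); last by move=> j _; rewrite lee_fin.
rewrite add0n; apply: lte_add_pinfty; first by rewrite sumEFin ltry.
apply: (@le_lt_trans _ _ (C * H)%:E); last exact: ltry.
apply: lime_le; first by apply: is_cvg_nneseries => j _ _; rewrite lee_fin.
by near=> N; rewrite sumEFin lee_fin.
Unshelve. all: by end_near. Qed.

End Summation.

Unset Implicit Arguments.
Set Strict Implicit.

Theorem theorem0p3 (R : realType) (n : nat) (n_gt0 : (0 < n)%N)
    (D : set 'rV[R[i]]_n) (z : nat -> 'rV[R[i]]_n) (h : R -> R) :
  strongly_pseudoconvex_bounded_domain D ->
  (forall j, D (z j)) ->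
  uniformly_discrete (kobayashi D) z ->
  (forall j, dist_boundary D (z j) < 1) ->
  (forall t, 0 <= t -> 0 <= h t) ->
  (forall s t, 0 <= s -> s <= t -> h s <= h t) ->
  (\sum_(1 <= m <oo) (h (1 / m%:R))%:E < +oo)%E ->
  (\sum_(0 <= j <oo)
     (dist_boundary D (z j) ^+ n *
      h (- (1 / ln (dist_boundary D (z j)))))%:E < +oo)%E.
Proof.
move=> [oD _ bD spc] Dz sep d1 h0 hmono hsum.
(* With an empty boundary every distance is the infimum of the empty set, 0. *)
have [bd0|bd0] := pselect (boundary D !=set0); last first.
  rewrite eseries0 ?ltry // => j _ _.
  have -> : dist_boundary D (z j) = 0.
    rewrite /dist_boundary (_ : [set _ | _ in _] = set0) ?inf0 //.
    by rewrite -subset0 => t [w bw _]; apply: bd0; exists w.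
  by rewrite expr0n gtn_eqF // mul0r.
have [lambda l0 inj] := uniformly_discrete_disk_separated Dz sep.
apply: summable_of_few_in_shells => //.
- by move=> j; rewrite d1 andbT; exact: dist_boundary_gt0.
- by move=> a a0; exact: (finitely_many_away_from_boundary oD bD Dz l0 inj a0).
- apply: few_in_all_shells => // p bp; have [U [r [def _]]] := spc p bp.
  have [rho [L [c [sigma [e chart]]]]] := boundary_chart_exists def bp.
  exists rho; first exact: (chart_rho chart).
  exact: (shell_count oD Dz l0 inj bp chart).
Qed.
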